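(* Let $n\in\mathbb{N}$, let $E$ be a nontrivial uniformly complete Archimedean real vector lattice, and let $Y$ be a real separated convex bornological space. Suppose $T\colon E^n\to Y$ is a bounded $n$-linear map. Then the following are equivalent. (i) $T$ is orthosymmetric. (ii) $T$ is total orderization invariant. (iii) $T$ is positively total orderization invariant.
   Context: $\mathbb{N}$ is the set of strictly positive integers and $[n]:=\{1,\dots,n\}$; nontrivial means $E\neq\{0\}$; $E^+$ is the positive cone of $E$. Uniformly complete means relatively uniformly complete: for every $u\in E^+$, every $u$-uniformly Cauchy sequence converges $u$-uniformly in $E$. A real convex bornological space is a real vector space $Y$ with a family of subsets (called bounded) that covers $Y$ and is closed under passing to subsets, finite unions, vector sums, multiplication by scalars, balanced hulls and convex hulls; it is separated if $\{0\}$ is the only bounded vector subspace. The vector lattice $E$ carries the bornology of order bounded sets, and a map $E^n\to Y$ is bounded if it maps products of order bounded subsets of $E$ to bounded subsets of $Y$. An $n$-linear map $T\colon E^n\to Y$ is orthosymmetric if $T(f_1,\dots,f_n)=0$ whenever $f_1,\dots,f_n\in E$ and $|f_i|\wedge|f_j|=0$ for some $i,j\in[n]$. For $f_1,\dots,f_n\in E$ and $k\in[n]$, $$\mathcal{M}_k(f_1,\dots,f_n)=\bigvee_{\substack{i_1,\dots,i_{n+1-k}\in[n]\\ i_1<i_2<\cdots<i_{n+1-k}}}\ \bigwedge_{j=1}^{n+1-k}f_{i_j}.$$ A map $T\colon E^n\to Y$ is total orderization invariant if $$T(f_1,\dots,f_n)=T\bigl(\mathcal{M}_1(f_1,\dots,f_n),\dots,\mathcal{M}_n(f_1,\dots,f_n)\bigr)$$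 for all $f_1,\dots,f_n\in E$, and positively total orderization invariant if this identity holds for all $f_1,\dots,f_n\in E^+$. *)

(* Defs.v *)
From HB Require Import structures.
From mathcomp Require Import all_boot all_order all_algebra.
From mathcomp Require Import boolp classical_sets interval_inference reals convex.

Set Implicit Arguments.
Unset Strict Implicit.
Unset Printing Implicit Defensive.

Import Order.TTheory GRing.Theory Num.Theory.

Local Open Scope classical_set_scope.
Local Open Scope ring_scope.

(* [vlat_meet] and [vlat_join] are fields of the mixin because Hierarchy Builder
   does not accept a further structure that inherits from both GRing.Zmodule and
   Order.Lattice; the instance below gives E its Order.Lattice structure. *)
HB.mixin Record isVectorLattice (R : numDomainType) E
    of GRing.Lmodule R E & Num.POrderedZmodule E := {
  vlat_lerD2r : forall z x y : E, x <= y -> x + z <= y + z;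
  vlat_scaler_ge0 : forall (a : R) (x : E), 0 <= a -> 0 <= x -> 0 <= a *: x;
  vlat_meet : E -> E -> E;
  vlat_join : E -> E -> E;
  vlat_lexI : forall x y z, (x <= vlat_meet y z) = (x <= y) && (x <= z);
  vlat_leUx : forall x y z, (vlat_join x y <= z) = (x <= z) && (y <= z)
}.

#[short(type="vectorLatticeType")]
HB.structure Definition VectorLattice (R : numDomainType) :=
  { E of isVectorLattice R E & GRing.Lmodule R E & Num.POrderedZmodule E }.

#[non_forgetful_inheritance]
HB.instance Definition _ (R : numDomainType) (E : vectorLatticeType R) :=
  Order.POrder_isMeetSemilattice.Build ring_display (VectorLattice.sort E)
    vlat_lexI.
#[non_forgetful_inheritance]
HB.instance Definition _ (R : numDomainType) (E : vectorLatticeType R) :=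
  Order.POrder_isJoinSemilattice.Build ring_display (VectorLattice.sort E)
    vlat_leUx.

Section VectorLatticeTheory.
Context {R : numDomainType}.
Implicit Type E : vectorLatticeType R.

Definition vabs {E} (x : E) : E := (x `|` - x)%O.

Definition archimedean_vlat E :=
  forall u v : E, 0 <= u -> 0 <= v -> (forall m : nat, u *+ m <= v) -> u = 0.

Definition uniformly_cauchy {E} (u : E) (x : nat -> E) :=
  forall e : R, 0 < e -> exists N : nat, forall p q : nat,
    (N <= p)%N -> (N <= q)%N -> vabs (x p - x q) <= e *: u.

Definition uniformly_converges {E} (u : E) (x : nat -> E) (l : E) :=
  forall e : R, 0 < e -> exists N : nat, forall p : nat,
    (N <= p)%N -> vabs (x p - l) <= e *: u.

Definition uniformly_complete E :=
  forall (u : E) (x : nat -> E), 0 <= u -> uniformly_cauchy u x ->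
    exists l : E, uniformly_converges u x l.

Definition order_bounded {E} (A : set E) := has_lbound A /\ has_ubound A.

(* A lattice has no neutral element for meet and join in general, so the fold
   starts at the head of the list; only nonempty lists are meaningful. *)
Definition meet_seq {E} (s : seq E) : E :=
  \big[Order.meet/head 0 s]_(x <- behead s) x.

Definition join_seq {E} (s : seq E) : E :=
  \big[Order.join/head 0 s]_(x <- behead s) x.

(* Indices start at 0: [orderization f k] is the usual M_{k+1}(f), a join over
   increasing tuples of n + 1 - (k + 1) = n - k indices. Since k < n, both the
   tuples and the list of tuples are nonempty. *)
Definition orderization {E n} (f : {ffun 'I_n -> E}) : {ffun 'I_n -> E} :=
  [ffun k : 'I_n =>
     join_seq [seq meet_seq [seq f i | i <- t]
              | t : (n - k).-tuple 'I_n <- enum {: (n - k).-tuple 'I_n}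
              & sorted (fun i j : 'I_n => (i < j)%N) t]].

End VectorLatticeTheory.

Definition balanced_set (R : numDomainType) (Y : lmodType R) (A : set Y) :=
  forall (a : R) (y : Y), `|a| <= 1 -> A y -> A (a *: y).

(* The bounded sets are the elements of [bornology]. *)
HB.mixin Record isConvexBornological (R : numDomainType) Y
    of GRing.Lmodule R Y := {
  bornology : set (set Y);
  bornology_cover : forall y : Y, exists2 A, bornology A & A y;
  bornology_sub : forall A B : set Y, A `<=` B -> bornology B -> bornology A;
  bornologyU : forall A B, bornology A -> bornology B -> bornology (A `|` B);
  bornologyD : forall A B, bornology A -> bornology B ->
    bornology [set x + y | x in A & y in B];
  bornologyZ : forall (a : R) A, bornology A -> bornology [set a *: x | x in A];
  bornology_balanced : forall A, bornology A ->
    bornology (smallest (@balanced_set R Y) A);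
  bornology_convex : forall A, bornology A ->
    bornology (smallest (@convex_set R Y) A)
}.

#[short(type="convexBornologicalType")]
HB.structure Definition ConvexBornological (R : numDomainType) :=
  { Y of isConvexBornological R Y & GRing.Lmodule R Y }.

Definition separated_bornology (R : numDomainType)
    (Y : convexBornologicalType R) :=
  forall V : set Y, submod_closed [in V] -> bornology V -> V = [set 0].

Section Maps.
Context {R : numDomainType}.

Definition multilinear {n} {E Y : lmodType R} (T : {ffun 'I_n -> E} -> Y) :=
  forall (i : 'I_n) (f : {ffun 'I_n -> E}),
    linear (fun x : E => T [ffun j => if j == i then x else f j]).

Definition bounded_map {n} {E : vectorLatticeType R}
    {Y : convexBornologicalType R} (T : {ffun 'I_n -> E} -> Y) :=
  forall A : 'I_n -> set E, (forall i, order_bounded (A i)) ->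
    bornology (T @` [set f : {ffun 'I_n -> E} | forall i, A i (f i)]).

Definition orthosymmetric {n} {E : vectorLatticeType R} {Y : lmodType R}
    (T : {ffun 'I_n -> E} -> Y) :=
  forall f : {ffun 'I_n -> E},
    (exists i j : 'I_n, (vabs (f i) `&` vabs (f j))%O = 0) -> T f = 0.

Definition total_orderization_invariant {n} {E : vectorLatticeType R}
    {Y : lmodType R} (T : {ffun 'I_n -> E} -> Y) :=
  forall f : {ffun 'I_n -> E}, T f = T (orderization f).

Definition positively_total_orderization_invariant {n}
    {E : vectorLatticeType R} {Y : lmodType R} (T : {ffun 'I_n -> E} -> Y) :=
  forall f : {ffun 'I_n -> E}, (forall i, 0 <= f i) -> T f = T (orderization f).

End Maps.

(* Main.v *)
(** Sorting f by comparators (f i, f j) -> (f i /\ f j, f i \/ f j) changes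
    neither [orderization f] nor, when T is symmetric in the coordinates i and j
    and vanishes on disjoint vectors, the value of T; it ends at an increasing
    tuple, which is its own orderization. So the point is that a bounded
    orthosymmetric bilinear map B is symmetric. For 0 <= f <= u cut f into m
    layers of thickness e = u / m, with differences q k of consecutive layers.
    Since q j and q k are disjoint for |j - k| > 1, orthosymmetry gives
      B f u - B u f = m * \sum_k (B (q k.+1) (q k) - B (q k) (q k.+1)).
    Grouping k by its residue mod 3 makes this m times a sum of six values of
    (+-) B on [0, e]^2, that is 1/m times an element of a fixed bounded set. As m
    is arbitrary and Y is separated, B f u = B u f. Conversely, for nonnegative f
    with two disjoint coordinates the first entry of [orderization f] is 0, and
    the general case follows by expanding into positive and negative parts. *)

From HB Require Import structures.
Require Import Defs.
From mathcomp Require Import all_boot all_order all_algebra.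
From mathcomp Require Import boolp classical_sets reals.
From mathcomp Require Import zify.
Import Order.TTheory GRing.Theory Num.Theory.
Local Open Scope ring_scope.

(** * Translations, parts, disjointness and layers in a vector lattice *)

Section VectorLatticeFacts.
Context {R : numDomainType} {E : vectorLatticeType R}.
Implicit Types x y z u d : E.

Lemma vlerD2r z x y : (x + z <= y + z) = (x <= y).
Proof.
apply/idP/idP => [|/vlat_lerD2r]; last exact.
by move=> /(vlat_lerD2r (- z)); rewrite !addrK.
Qed.

Lemma vlerD2l z x y : (z + x <= z + y) = (x <= y).
Proof. by rewrite ![z + _]addrC vlerD2r. Qed.

Lemma vsubr_ge0 x y : (0 <= y - x) = (x <= y).
Proof. by rewrite -(vlerD2r x 0) add0r subrK. Qed.

Lemma vlerBlDr x y z : (x - y <= z) = (x <= z + y).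
Proof. by rewrite -(vlerD2r y (x - y)) subrK. Qed.

Lemma vlerBrDr x y z : (x <= y - z) = (x + z <= y).
Proof. by rewrite -(vlerD2r z x) subrK. Qed.

Lemma vlerD {x y z d} : x <= y -> z <= d -> x + z <= y + d.
Proof. by move=> xy zd; apply: (@le_trans _ _ (y + z)); rewrite ?vlerD2r ?vlerD2l. Qed.

Lemma vaddr_ge0 {x y} : 0 <= x -> 0 <= y -> 0 <= x + y.
Proof. by move=> x0 y0; rewrite -(addr0 0) vlerD. Qed.

Lemma vlerN2 x y : (- x <= - y) = (y <= x).
Proof. by rewrite -(vlerD2r (x + y) (- x)) addKr addrCA addNr addr0. Qed.

Lemma vlerNl x y : (- x <= y) = (- y <= x).
Proof. by rewrite -[in RHS]vlerN2 opprK. Qed.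

Lemma vlerNr x y : (x <= - y) = (y <= - x).
Proof. by rewrite -[in RHS]vlerN2 opprK. Qed.

Lemma vsumr_ge0 (I : Type) (s : seq I) (P : pred I) (F : I -> E) :
  (forall i, P i -> 0 <= F i) -> 0 <= \sum_(i <- s | P i) F i.
Proof. by move=> F0; elim/big_rec: _ => // i y /F0 Fi y0; apply: vaddr_ge0. Qed.

Lemma vjoin_addr x y z : ((x `|` y) + z = (x + z) `|` (y + z))%O.
Proof.
apply/le_anti/andP; split; last by rewrite leUx !vlerD2r leUl leUr.
by rewrite -vlerBrDr leUx !vlerBrDr leUl leUr.
Qed.

Lemma vmeet_addr x y z : ((x `&` y) + z = (x + z) `&` (y + z))%O.
Proof.
apply/le_anti/andP; split; first by rewrite lexI !vlerD2r leIl leIr.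
by rewrite -vlerBlDr lexI !vlerBlDr leIl leIr.
Qed.

Lemma voppr_join x y : (- (x `|` y) = - x `&` - y)%O.
Proof.
apply/le_anti/andP; split; first by rewrite lexI !vlerN2 leUl leUr.
by rewrite vlerNr leUx; apply/andP; split; rewrite vlerNr ?leIl ?leIr.
Qed.

(** Subtracting [x \/ y] from [x + y] means adding [- x /\ - y], and translating this meet by
    [x + y] gives [y /\ x]. *)
Lemma vaddr_meet_join x y : ((x `&` y) + (x `|` y) = x + y)%O.
Proof.
apply/eqP; rewrite eq_sym -subr_eq voppr_join addrC vmeet_addr addKr addrC addrK.
by rewrite meetC.
Qed.

(** Lattice-ordered groups are distributive: with [w] the right-hand side, the identity
    [z = d /\ z + d \/ z - d] bounds both [x] and [y] by [w + d \/ (x \/ y) - d]. Their join obeys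
    the same bound, and the identity for [z = x \/ y] turns it into the claim. *)
Lemma vmeetUr d x y : (d `&` (x `|` y) = (d `&` x) `|` (d `&` y))%O.
Proof.
apply/le_anti/andP; split; last first.
  by rewrite leUx !leI2 // ?leUl ?leUr.
set w := (_ `|` (_ `&` y))%O.
have bound z : (z <= x `|` y)%O -> (d `&` z <= w)%O ->
    (z <= w + (d `|` (x `|` y)) - d)%O.
  move=> zxy zw; rewrite vlerBrDr addrC -(vaddr_meet_join d z) vlerD //.
  by rewrite leUx leUl (le_trans zxy (leUr _ _)).
have : (x `|` y <= w + (d `|` (x `|` y)) - d)%O.
  by rewrite leUx !bound ?leUl ?leUr.
by rewrite vlerBrDr addrC -(vaddr_meet_join d (_ `|` _)%O) vlerD2r.
Qed.

Definition vpos x : E := (x `|` 0)%O.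

Lemma vpos_ge0 x : 0 <= vpos x. Proof. exact: leUr. Qed.

Lemma vpos_ge x : x <= vpos x. Proof. exact: leUl. Qed.

Lemma le_vpos x y : x <= y -> vpos x <= vpos y.
Proof. by move=> xy; apply: leU2. Qed.

Lemma ge0_vpos x : 0 <= x -> vpos x = x.
Proof. exact: join_l. Qed.

Lemma le0_vpos x : x <= 0 -> vpos x = 0.
Proof. exact: join_r. Qed.

Lemma vposB x : vpos x - vpos (- x) = x.
Proof.
by rewrite /vpos voppr_join opprK oppr0 addrC vaddr_meet_join addr0.
Qed.

(** As [vpos x = x + vpos (- x)], the meet is [(x /\ 0) + vpos (- x)], and
    [x /\ 0 = - vpos (- x)]. *)
Lemma vpos_disjoint x : (vpos x `&` vpos (- x) = 0)%O.
Proof.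
have -> : vpos x = x + vpos (- x) by rewrite -{2}(vposB x) subrK.
rewrite -{2}[vpos (- x)]add0r -vmeet_addr.
by rewrite -[vpos _]opprK /vpos voppr_join opprK oppr0 subrr.
Qed.

Lemma vmeet0_le x y u d :
  0 <= x -> 0 <= y -> x <= u -> y <= d -> (u `&` d = 0)%O -> (x `&` y = 0)%O.
Proof.
by move=> x0 y0 xu yd ud; apply/le_anti; rewrite -{1}ud leI2 //= lexI x0 y0.
Qed.

Lemma ge0_vabs x : 0 <= x -> vabs x = x.
Proof.
by move=> x0; apply: join_l; apply: (le_trans _ x0); rewrite vlerNl oppr0.
Qed.

Lemma vabs_ge0 x : 0 <= vabs x.
Proof.
have w2 : - vabs x <= vabs x.
  by apply: (@le_trans _ _ x); [rewrite vlerNl leUr | exact: leUl].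
(* With [w = vabs x], the element [- w] lies below both [vpos w] and [vpos (- w)], whose meet is
   0. *)
rewrite -(opprK (vabs x)) vlerNr oppr0 -(vpos_disjoint (vabs x)) lexI vpos_ge.
by rewrite (le_trans w2 (vpos_ge _)).
Qed.

Lemma vpos_le_vabs x : vpos x <= vabs x.
Proof. by rewrite leUx leUl vabs_ge0. Qed.

Lemma vposN_le_vabs x : vpos (- x) <= vabs x.
Proof. by rewrite leUx leUr vabs_ge0. Qed.

(* The layers of f at the levels k e are c k.+1; c 0 (which is in fact e) is the
   layer below level 0, so that every layer has a predecessor. *)
Lemma layer_decomposition (e f : E) (m : nat) :
    0 <= e -> 0 <= f -> f <= e *+ m ->
  exists c : nat -> E,
    [/\ \sum_(k < m) c k.+1 = f, forall k, 0 <= c k <= e,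
        forall k, c k.+1 <= c k
      & forall i j, (i < j)%N -> (c j `&` (e - c i) = 0)%O].
Proof.
move=> e0 f0 fm; pose a k := f - e *+ k.
have aS k : a k.+1 + e = a k by rewrite /a mulrSr opprD addrA subrK.
pose c k := vpos (a k + e) - vpos (a k).
have c_ge0 k : 0 <= c k by rewrite vsubr_ge0 le_vpos // -{1}[a k]addr0 vlerD.
have c_le k : c k <= e.
  rewrite vlerBlDr addrC leUx vlerD ?vpos_ge //=.
  by rewrite vaddr_ge0 ?vpos_ge0.
have eB_ge0 k : 0 <= e - c k by rewrite vsubr_ge0.
(* The two terms are dominated by the positive and the negative part of [a k]. *)
have dis1 k : (c k.+1 `&` (e - c k) = 0)%O.
  apply: (vmeet0_le _ _ _ _ (c_ge0 _) (eB_ge0 _) _ _ (vpos_disjoint (a k))).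
    by rewrite /c aS vlerBlDr -{1}[vpos (a k)]addr0 vlerD ?vpos_ge0.
  rewrite /c opprB addrA vlerBlDr -{1}[vpos (a k)](subrK (vpos (- a k))) vposB.
  by rewrite addrA [e + _]addrC [_ + vpos (- _)]addrC vlerD2l vpos_ge.
(* By disjointness [c k.+1 + (e - c k)] is the join of its two terms, each of which is at most
   [e]. *)
have c_decr k : c k.+1 <= c k.
  rewrite -(vlerD2r (e - c k)) [c k + _]addrC subrK -vaddr_meet_join dis1 add0r.
  by rewrite leUx c_le vlerBlDr -{1}[e]addr0 vlerD.
have c_homo i j : (i <= j)%N -> c j <= c i.
  by move/subnK <-; elim: (j - i)%N => // k; apply: (le_trans (c_decr _)).
exists c; split=> [|k|//|i j ij].
(* The sum telescopes to [vpos (a 0) - vpos (a m)], and the last term is 0 because [f <= e *+ m]. *)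
- rewrite -(big_mkord xpredT (fun k => c k.+1)).
  rewrite (telescope_sumr_eq (fun k => - vpos (a k))) // => [|k _].
    rewrite le0_vpos; last by rewrite vlerBlDr add0r.
    by rewrite /a mulr0n subr0 ge0_vpos // oppr0 opprK add0r.
  by rewrite /c aS opprK addrC.
- by rewrite c_ge0 c_le.
- apply: (vmeet0_le _ _ _ _ (c_ge0 _) (eB_ge0 _) _ (lexx _) (dis1 i)).
  exact: c_homo.
Qed.

End VectorLatticeFacts.

(** * Additivity and homogeneity of maps given with a separate proof of linearity *)

Section LinearFacts.
Context {R : pzRingType} {U V : lmodType R} {g : U -> V} (g_lin : linear g).

Let gl : {linear U -> V} :=
  HB.pack_for {linear U -> V} g (GRing.isLinear.Build R U V *:%R g g_lin).

Lemma lin0 : g 0 = 0. Proof. exact: (raddf0 gl). Qed.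
Lemma linD x y : g (x + y) = g x + g y. Proof. exact: (raddfD gl). Qed.
Lemma linB x y : g (x - y) = g x - g y. Proof. exact: (raddfB gl). Qed.
Lemma linZ a x : g (a *: x) = a *: g x. Proof. exact: (linearZ_LR gl). Qed.
Lemma lin_sum (I : Type) (r : seq I) (P : pred I) (F : I -> U) :
  g (\sum_(i <- r | P i) F i) = \sum_(i <- r | P i) g (F i).
Proof. exact: (raddf_sum gl). Qed.

End LinearFacts.

(** * The defect of symmetry of an orthosymmetric bilinear map, in terms of layers *)

Section BilinearSymmetry.
Context {R : realType} {E : vectorLatticeType R} {Y : lmodType R}.
Context (B : E -> E -> Y).
Context (linl : forall y, linear (B^~ y)) (linr : forall x, linear (B x)).
Context (orth : forall x y : E, (x `&` y)%O = 0 -> B x y = 0).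

(** What matters is that the number of summands and the bound [e] on their arguments do not depend
    on [m]: [a r] and [b r] collect the [q k.+1] and the [q k] with [k] in the residue class [r] mod
    3. *)
Lemma bilinear_swap_layers (e f : E) (m : nat) :
    0 <= e -> 0 <= f -> f <= e *+ m ->
  exists a b : 'I_3 -> E,
    [/\ forall r, 0 <= a r <= e, forall r, 0 <= b r <= e
      & B f e - B e f = \sum_r (B (a r) (b r) - B (b r) (a r))].
Proof.
move=> e0 f0 fm.
have [c [sumc c_bd c_decr dis]] := layer_decomposition e f m e0 f0 fm.
have c_ge0 k : 0 <= c k by case/andP: (c_bd k).
have c_le k : c k <= e by case/andP: (c_bd k).
have dis' i j : (i < j)%N -> ((e - c i) `&` c j = 0)%O by rewrite meetC; apply: dis.
pose q k := c k - c k.+1.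
have q_ge0 k : 0 <= q k by rewrite vsubr_ge0.
(* [q j] is at most [c j] and [q i] is at most [e - c i.+1]. *)
have q_dis i j : (i.+1 < j)%N -> (q j `&` q i = 0)%O.
  move=> ij; apply: (vmeet0_le _ _ _ _ _ _ _ _ (dis _ _ ij)) => //.
    by rewrite vlerBlDr -{1}[c j]addr0 vlerD.
  by rewrite vlerD2r.
have q_B0 i j : (i.+1 < j)%N -> B (q j) (q i) = 0 /\ B (q i) (q j) = 0.
  by move=> ij; split; apply: orth; [|rewrite meetC]; apply: q_dis.
(* Splitting [e = h k.+1 + c k.+1], the diagonal terms cancel. On the right, with
   [q k = h k.+1 - h k], every product of some [c j] and [h i] with [i < j] vanishes, which leaves
   only [c k.+1] against [h k.+1]. *)
have step k : B (c k.+1) e - B e (c k.+1) = B (q k.+1) (q k) - B (q k) (q k.+1).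
  pose h i := e - c i.
  have hB0 i j : (i < j)%N -> B (c j) (h i) = 0 /\ B (h i) (c j) = 0.
    by move=> ij; split; apply: orth; [apply: dis | apply: dis'].
  have qh : q k = h k.+1 - h k by rewrite opprB addrC addrA subrK.
  have -> : B (c k.+1) e = B (c k.+1) (h k.+1) + B (c k.+1) (c k.+1).
    by rewrite -(linD (linr _)) subrK.
  have -> : B e (c k.+1) = B (h k.+1) (c k.+1) + B (c k.+1) (c k.+1).
    by rewrite -(linD (linl _)) subrK.
  clearbody h; rewrite opprD addrACA subrr addr0 qh /q !(linB (linl _), linB (linr _)).
  have [-> ->] := hB0 k k.+1 (ltnSn _); have [-> ->] := hB0 k k.+2 (leqnSn _).
  by have [-> ->] := hB0 k.+1 k.+2 (ltnSn _); rewrite !subr0.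
pose res (r : nat) (k : 'I_m) := (k %% 3 == r)%N.
have sum_le (F : nat -> E) (r : nat) : (forall k, 0 <= F k) ->
    0 <= \sum_(k < m | res r k) F k <= \sum_(k < m) F k.
  move=> F0; rewrite vsumr_ge0 //= [leRHS](bigID (res r)) /=.
  by rewrite -{1}[X in X <= _]addr0 vlerD // vsumr_ge0.
(* The shift [j] is 1 for the bound on [a] and 0 for the bound on [b]. *)
have sum_q j : \sum_(k < m) q (j + k)%N = c j - c (j + m)%N.
  rewrite -(big_mkord xpredT (fun k => q (j + k)%N)).
  rewrite (telescope_sumr_eq (fun k => - c (j + k)%N)) // => [|k _].
    by rewrite addn0 opprK addrC.
  by rewrite addnS opprK addrC.
have sum_q_le j : \sum_(k < m) q (j + k)%N <= e.
  by rewrite sum_q vlerBlDr -{1}[c j]addr0 vlerD.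
exists (fun r : 'I_3 => \sum_(k < m | res r k) q k.+1),
  (fun r : 'I_3 => \sum_(k < m | res r k) q k).
split=> [r|r|].
- have /andP[-> /= /le_trans] := sum_le (fun k => q k.+1) r (fun k => q_ge0 _).
  by apply; apply: (sum_q_le 1%N).
- have /andP[-> /= /le_trans] := sum_le q r q_ge0.
  by apply; apply: (sum_q_le 0%N).
have -> : B f e - B e f = \sum_(k < m) (B (q k.+1) (q k) - B (q k) (q k.+1)).
  rewrite -sumc (lin_sum (linl _)) (lin_sum (linr _)) -sumrB.
  exact: eq_bigr.
rewrite (partition_big (fun k : 'I_m => inord (k %% 3) : 'I_3) xpredT) //=.
apply: eq_bigr => r _.
have resE k : (inord (k %% 3) == r :> 'I_3) = (k %% 3 == r)%N.
  by rewrite -val_eqE /= inordK ?ltn_pmod.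
rewrite (eq_bigl (res r)) => [|k]; last exact: resE.
rewrite (lin_sum (linl _)) (lin_sum (linr _)) -sumrB; apply: eq_bigr => k /eqP kr.
rewrite (lin_sum (linr _)) (lin_sum (linl _)) -sumrB (bigD1 k) ?/res ?kr //=.
rewrite big1 ?addr0 // => l /andP[/eqP lr lk].
(* For distinct [l] and [k] in one class mod 3, the indices [l] and [k.+1] differ by at least 2. Mod
   2 would fail: [l = k.+2] is adjacent to [k.+1]. *)
have [kl|kl] : (k.+2 < l)%N \/ (l.+1 < k.+1)%N.
    by move: lk kr; rewrite -lr -val_eqE /=; lia.
- by have [-> ->] := q_B0 _ _ kl; rewrite subrr.
- by have [-> ->] := q_B0 _ _ kl; rewrite subrr.
Qed.

End BilinearSymmetry.

(** * Symmetry of bounded orthosymmetric bilinear maps *)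

Section BornologicalSymmetry.
Local Open Scope classical_set_scope.
Context {R : realType} {E : vectorLatticeType R} {Y : convexBornologicalType R}.

(** The whole line through [y] lies in the balanced hull of [W], so it is a bounded subspace and
    separation makes it trivial. *)
Lemma bornology_line0 (Ysep : separated_bornology Y) (W : set Y) (y : Y) :
  bornology W -> (forall m : nat, W (m.+1%:R *: y)) -> y = 0.
Proof.
move=> Wb Wy; pose V : set Y := [set z | exists a : R, z = a *: y].
suff V0 : V = [set 0].
  by have : V y by [exists 1; rewrite scale1r]; rewrite V0.
apply: Ysep.
  split; first by rewrite inE; exists 0; rewrite scale0r.
  move=> a u v; rewrite !inE => -[b ->] [c ->].
  by exists (a * b + c); rewrite scalerA scalerDl.
apply: (bornology_sub V _ _ (bornology_balanced W Wb)) => z [a ->] M [Mbal WM].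
pose m := Num.truncn `|a|.
have m_gt0 : (0 : R) < m.+1%:R by rewrite ltr0n.
have -> : a *: y = (a / m.+1%:R) *: (m.+1%:R *: y).
  by rewrite scalerA divfK // gt_eqF.
apply: Mbal; last exact: WM.
rewrite normrM normfV (gtr0_norm m_gt0) ler_pdivrMr // mul1r ltW //.
exact: truncnS_gt.
Qed.

Lemma bounded_bilinear_symmetric (Ysep : separated_bornology Y) (B : E -> E -> Y)
    (linl : forall y, linear (B^~ y)) (linr : forall x, linear (B x))
    (orth : forall x y : E, (x `&` y)%O = 0 -> B x y = 0)
    (bdd : forall u : E,
      bornology [set B x y | x in [set x | 0 <= x <= u] & y in [set y | 0 <= y <= u]]) :
  forall x y, B x y = B y x.
Proof.
have swap_le (u f : E) : 0 <= f -> f <= u -> B f u = B u f.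
  move=> f0 fu; pose P : set Y :=
    [set B x y | x in [set x | 0 <= x <= u] & y in [set y | 0 <= y <= u]].
  (* [Q] is the difference set [P - P]; the bounded set used below is a sum of three copies of it,
     one for each residue mod 3. *)
  pose Q : set Y := [set x + y | x in P & y in [set -1 *: z | z in P]].
  pose Q2 : set Y := [set x + y | x in Q & y in Q].
  have Qb : bornology Q by apply: bornologyD; [|apply: bornologyZ]; apply: bdd.
  apply/eqP; rewrite -subr_eq0; apply/eqP.
  apply: (@bornology_line0 Ysep [set x + y | x in Q2 & y in Q]).
    by apply: bornologyD => //; apply: bornologyD.
  move=> m; have u0 := le_trans f0 fu.
  pose e := m.+1%:R^-1 *: u.
  have mK : m.+1%:R * m.+1%:R^-1 = 1 :> R by rewrite divff ?pnatr_eq0.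
  have eK : m.+1%:R *: e = u by rewrite scalerA mK scale1r.
  have e0 : 0 <= e by apply: vlat_scaler_ge0 => //; rewrite invr_ge0 ler0n.
  have fe : f <= e *+ m.+1 by rewrite -scaler_nat eK.
  have [a [b [a_bd b_bd]]] := bilinear_swap_layers B linl linr orth e f _ e0 f0 fe.
  rewrite /e (linZ (linl _)) (linZ (linr _)) -scalerBr => D.
  have in_bd (x : E) : 0 <= x <= e -> 0 <= m.+1%:R *: x <= u.
    case/andP=> x0 xe; rewrite vlat_scaler_ge0 ?ler0n //= -eK -vsubr_ge0 -scalerBr.
    by rewrite vlat_scaler_ge0 ?ler0n ?vsubr_ge0.
  have inQ r : Q ((m.+1%:R * m.+1%:R) *: (B (a r) (b r) - B (b r) (a r))).
    exists (B (m.+1%:R *: a r) (m.+1%:R *: b r)).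
      by exists (m.+1%:R *: a r); [|exists (m.+1%:R *: b r)] => //; apply: in_bd.
    exists (- B (m.+1%:R *: b r) (m.+1%:R *: a r)).
      exists (B (m.+1%:R *: b r) (m.+1%:R *: a r)); last by rewrite scaleN1r.
      by exists (m.+1%:R *: b r); [|exists (m.+1%:R *: a r)] => //; apply: in_bd.
    by rewrite !(linZ (linl _)) !(linZ (linr _)) !scalerA -scalerBr.
  (* The square rescales both arguments from [[0, e]] to [[0, u]]; one of its two factors is
     absorbed on the left by [e], so a factor [m.+1] survives. *)
  have -> : m.+1%:R *: (B f u - B u f) =
      (m.+1%:R * m.+1%:R) *: (m.+1%:R^-1 *: (B f u - B u f)).
    by rewrite scalerA -mulrA mK mulr1.
  rewrite D scaler_sumr !big_ord_recr big_ord0 /= add0r.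
  have inD (A C : set Y) x y : A x -> C y -> [set x + y | x in A & y in C] (x + y).
    by move=> Ax Cy; exists x => //; exists y.
  exact: (inD _ _ _ _ (inD _ _ _ _ (inQ _) (inQ _)) (inQ _)).
(* Comparability is removed by swapping [x] with [x + y] and cancelling [B x x]. *)
have swap_ge0 (x y : E) : 0 <= x -> 0 <= y -> B x y = B y x.
  move=> x0 y0; have : B x (x + y) = B (x + y) x.
    by apply: swap_le; rewrite // -{1}[x]addr0 vlerD.
  by rewrite (linD (linr _)) (linD (linl _)) => /addrI.
move=> x y; rewrite -(vposB x) -(vposB y) !(linB (linl _), linB (linr _)).
have swap_pos z w : B (vpos z) (vpos w) = B (vpos w) (vpos z).
  by apply: swap_ge0; apply: vpos_ge0.
rewrite [B (vpos y) (vpos x)]swap_pos [B (vpos y) (vpos (- x))]swap_pos.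
rewrite [B (vpos (- y)) (vpos x)]swap_pos [B (vpos (- y)) (vpos (- x))]swap_pos.
by rewrite !opprB addrACA [in RHS]addrACA [- _ - _ in RHS]addrC.
Qed.

End BornologicalSymmetry.

(** * Comparators, and the orderization as an invariant of sorting *)

Section Sorting.
Local Set Implicit Arguments.
Local Unset Strict Implicit.
Context {R : numDomainType} {E : vectorLatticeType R} {n : nat}.
Implicit Types (f g : {ffun 'I_n -> E}) (i j k : 'I_n).

Definition subst_coord f i (x : E) : {ffun 'I_n -> E} :=
  [ffun j => if j == i then x else f j].

Lemma subst_coord_id f i : subst_coord f i (f i) = f.
Proof. by apply/ffunP=> k; rewrite ffunE; case: eqP => [->|]. Qed.

Lemma subst_coordC f i j x y :
  i != j -> subst_coord (subst_coord f i x) j y = subst_coord (subst_coord f j y) i x.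
Proof.
move=> ij; apply/ffunP=> k; rewrite !ffunE.
by case: (eqVneq k j) => // ->; rewrite eq_sym (negPf ij).
Qed.

Definition sort2 i j f : {ffun 'I_n -> E} :=
  subst_coord (subst_coord f i (f i `&` f j)%O) j (f i `|` f j)%O.

(** [E] need not be totally ordered, so sorting uses a fixed sequence of comparators, as in a
    sorting network. Any property [P] preserved by comparators is carried along. *)
Lemma selection_sort (P : {ffun 'I_n -> E} -> Prop) f :
    (forall i j g, (i < j)%N -> P g -> P (sort2 i j g)) -> P f ->
  exists2 g : {ffun 'I_n -> E}, (forall i j, (i <= j)%N -> g i <= g j) & P g.
Proof.
move=> Psort Pf; pose below m (g : {ffun 'I_n -> E}) :=
  forall i j : 'I_n, (i < m)%N -> (i < j)%N -> g i <= g j.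
suff /(_ n (leqnn n)) [g gn Pg] : forall m, (m <= n)%N -> exists2 g, below m g & P g.
  by exists g => // i j; rewrite leq_eqVlt => /orP[/eqP/val_inj->//|]; apply: gn.
elim=> [_|m IHm mn]; first by exists f.
have [g gm Pg] := IHm (ltnW mn); pose i0 := Ordinal mn.
(* Round [m] compares position [m] with each later position in turn; [l] bounds the positions
   already visited. Lower bounds of two entries also bound their meet and join, so the earlier
   rounds are not spoilt. *)
have /(_ n) [h [hm hi0 Ph]] : forall l, exists h : {ffun 'I_n -> E}, [/\ below m h,
    forall j : 'I_n, (m < j)%N -> (j < l)%N -> h i0 <= h j & P h].
  elim=> [|l [h [hm hl Ph]]]; first by exists g.
  case: (boolP (m < l < n)%N) => [/andP[ml ln]|mln]; last first.
    exists h; split=> // j mj; rewrite ltnS leq_eqVlt => /orP[/eqP jl|]; last exact: hl.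
    by move: mln; rewrite -jl mj ltn_ord.
  pose j0 := Ordinal ln; exists (sort2 i0 j0 h); split; last exact: Psort.
    move=> i j im ij; rewrite !ffunE.
    have -> : (i == j0) = false by apply: ltn_eqF => /=; lia.
    have -> : (i == i0) = false by apply: ltn_eqF => /=; lia.
    case: eqP => _; first by rewrite lexUl // hm.
    by case: eqP => _; [rewrite lexI !hm //=; lia | exact: hm].
  move=> j mj jl; rewrite !ffunE eqxx.
  have -> : (i0 == j0) = false by apply: ltn_eqF.
  have -> : (j == i0) = false by apply: gtn_eqF.
  case: eqP => [_|/eqP jj0]; first by rewrite lexUl // leIl.
  apply: (le_trans (leIl _ _)); apply: hl => //.
  by move: jj0; rewrite -val_eqE /=; lia.
exists h => // i j; rewrite ltnS leq_eqVlt => /orP[/eqP im ij|]; last exact: hm.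
have -> : i = i0 by apply: val_inj.
by apply: hi0; rewrite // -im.
Qed.

Lemma le_meet_seq (s : seq E) x :
  s != [::] -> (x <= meet_seq s) = all (fun y => x <= y) s.
Proof.
case: s => // y s _; rewrite /meet_seq /=.
elim: s => [|z s IHs]; first by rewrite big_nil andbT.
by rewrite big_cons lexI IHs /= andbCA.
Qed.

Lemma join_seq_le (s : seq E) x :
  s != [::] -> (join_seq s <= x) = all (fun y => y <= x) s.
Proof.
case: s => // y s _; rewrite /join_seq /=.
elim: s => [|z s IHs]; first by rewrite big_nil andbT.
by rewrite big_cons leUx IHs /= andbCA.
Qed.

Lemma sorted_enum (S : {set 'I_n}) : sorted (fun i j : 'I_n => (i < j)%N) (enum S).
Proof.
rewrite {1}/enum_mem sorted_filter //; first by move=> ? ? ?; apply: ltn_trans.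
have := iota_ltn_sorted 0 n; rewrite -val_enum_ord enumT.
by rewrite (sorted_map (f := val)).
Qed.

Lemma card_ord_ge (m : nat) : (m <= n)%N -> #|[set i : 'I_n | (m <= i)%N]| = (n - m)%N.
Proof.
move=> mn; have := cardsC [set i : 'I_n | (i < m)%N]; rewrite card_ord.
have -> : ~: [set i : 'I_n | (i < m)%N] = [set i : 'I_n | (m <= i)%N].
  by apply/setP => i; rewrite !inE -leqNgt.
have -> : #|[set i : 'I_n | (i < m)%N]| = m.
  by rewrite -sum1dep_card -(big_ord_widen _ (fun=> 1%N)) // sum1_card card_ord.
by move/(congr1 (subn^~ m)); rewrite addKn.
Qed.

(** Increasing tuples are the enumerations of sets of [n - k] indices, and a meet is tested through
    its lower bounds [d]. This form avoids the folds in all later arguments. *)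
Lemma orderization_leP f k z :
  orderization f k <= z <->
  forall S : {set 'I_n}, #|S| = (n - k)%N ->
    forall d, (forall i, i \in S -> d <= f i) -> d <= z.
Proof.
have nk_gt0 : (0 < n - k)%N by rewrite subn_gt0.
have map_neq0 (t : (n - k).-tuple 'I_n) : [seq f i | i <- t] != [::].
  by rewrite -size_eq0 size_map size_tuple -lt0n.
set s := [seq meet_seq [seq f i | i <- t] | t : (n - k).-tuple 'I_n <-
  enum {: (n - k).-tuple 'I_n} & sorted (fun i j : 'I_n => (i < j)%N) t].
have fE : orderization f k = join_seq s by rewrite ffunE.
have size_enum (S : {set 'I_n}) : #|S| = (n - k)%N -> size (enum S) = (n - k)%N.
  by rewrite -cardE.
have meet_in_s (S : {set 'I_n}) : #|S| = (n - k)%N ->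
    meet_seq [seq f i | i <- enum S] \in s.
  move=> cS; have sS : size (enum S) == (n - k)%N by rewrite size_enum.
  apply/mapP; exists (Tuple sS) => //=.
  by rewrite mem_filter mem_enum andbT; apply: sorted_enum.
(* The last [n - k] indices provide a member, so [join_seq s] is a genuine join and not the default
   value. *)
have s_neq0 : s != [::].
  have := meet_in_s _ (card_ord_ge (ltnW (ltn_ord k))).
  by case: (s).
rewrite fE join_seq_le //; split=> [/allP sz S cS d dS|Hz].
  apply: le_trans (sz _ (meet_in_s S cS)).
  rewrite le_meet_seq; last first.
    by rewrite -size_eq0 size_map size_enum // -lt0n.
  by apply/allP => _ /mapP[i iS ->]; apply: dS; rewrite -mem_enum.
apply/allP => y /mapP[t]; rewrite mem_filter => /andP[t_sorted _ yE]; rewrite yE.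
apply: (Hz [set i in t]).
  rewrite cardsE -[RHS](size_tuple t); apply/card_uniqP.
  apply: sorted_uniq t_sorted; first by move=> ? ? ?; apply: ltn_trans.
  by move=> ?; apply: ltnn.
move=> i; rewrite inE => it.
have := lexx (meet_seq [seq f i | i <- t]); rewrite {1}le_meet_seq // => /allP; apply.
exact: map_f.
Qed.

Lemma orderization_ge f k (S : {set 'I_n}) d :
  #|S| = (n - k)%N -> (forall i, i \in S -> d <= f i) -> d <= orderization f k.
Proof.
by move=> cS dS; have /orderization_leP := lexx (orderization f k); apply; eassumption.
Qed.

(** Only [n - k - 1] indices exceed [k], so each set of [n - k] indices contains some [i <= k], and
    its meet is at most [f k]. The set of all [i >= k] attains this value. *)
Lemma orderization_homo f :
  (forall i j, (i <= j)%N -> f i <= f j) -> orderization f = f.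
Proof.
move=> f_homo; apply/ffunP => k; apply/le_anti/andP; split.
  apply/orderization_leP => S cS d dS.
  have [i iS ik] : exists2 i : 'I_n, i \in S & (i <= k)%N.
    apply/exists_inP/contraT; rewrite negb_exists_in => /forall_inP Sk.
    have : S \subset [set i : 'I_n | (k < i)%N].
      by apply/fintype.subsetP => i /Sk; rewrite inE -ltnNge.
    move/subset_leq_card; rewrite cS card_ord_ge; last exact: ltn_ord.
    by have := ltn_ord k; lia.
  by apply: le_trans (f_homo _ _ ik); apply: dS.
apply: (orderization_ge (card_ord_ge _)); first exact: ltnW.
by move=> i; rewrite inE; apply: f_homo.
Qed.

(** Each lower bound over an index set for one tuple is matched by lower bounds over sets of equal
    size for the other. The set needs changing only when it contains exactly one of [i] and [j]. *)
Lemma orderization_sort2 f i j : i != j -> orderization (sort2 i j f) = orderization f.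
Proof.
move=> ij; set g := sort2 i j f; apply/ffunP => k.
have gi : g i = (f i `&` f j)%O by rewrite !ffunE (negPf ij) eqxx.
have gj : g j = (f i `|` f j)%O by rewrite !ffunE eqxx.
have gl l : l != i -> l != j -> g l = f l by rewrite !ffunE => /negPf-> /negPf->.
have swap (S : {set 'I_n}) x y : x \in S -> y \notin S -> #|y |: (S :\ x)| = #|S|.
  move=> xS yS; rewrite cardsU1 !inE (negPf yS) andbF.
  by rewrite (cardsD1 x S) xS.
apply/le_anti/andP; split; apply/orderization_leP => S cS d dS.
- case: (boolP (i \in S)) => iS; last first.
    case: (boolP (j \in S)) => jS; last first.
      apply: (orderization_ge cS) => l lS; rewrite -gl ?dS //.
        by apply: contraNneq iS => <-.
      by apply: contraNneq jS => <-.
    (* Here only [d <= f i \/ f j] is known. Distributivity splits [d] into two parts: the first is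
       a lower bound over [S] with [j] exchanged for [i], the second over [S] itself. *)
    have dij : d = ((d `&` f i) `|` (d `&` f j))%O.
      by rewrite -vmeetUr meet_l // -gj dS.
    rewrite dij leUx; apply/andP; split.
      apply: (@orderization_ge _ _ (i |: (S :\ j))); first by rewrite swap.
      move=> l; rewrite !inE => /orP[/eqP->|/andP[lj lS]]; first exact: leIr.
      rewrite (le_trans (leIl _ _)) // -gl ?dS //.
      by apply: contraNneq iS => <-.
    apply: (orderization_ge cS) => l lS.
    case: (eqVneq l j) => [->|lj]; first exact: leIr.
    rewrite (le_trans (leIl _ _)) // -gl ?dS //.
    by apply: contraNneq iS => <-.
  have dfi : d <= f i by apply: le_trans (dS i iS) _; rewrite gi leIl.
  have dfj : d <= f j by apply: le_trans (dS i iS) _; rewrite gi leIr.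
  apply: (orderization_ge cS) => l lS.
  by case: (eqVneq l i) => [->//|li]; case: (eqVneq l j) => [->//|lj]; rewrite -gl ?dS.
- case: (boolP (i \in S)) => iS; last first.
    apply: (orderization_ge cS) => l lS.
    have li : l != i by apply: contraNneq iS => <-.
    case: (eqVneq l j) => [lj|lj]; last by rewrite gl ?dS.
    by rewrite lj gj lexUr // dS // -lj.
  case: (boolP (j \in S)) => jS.
    apply: (orderization_ge cS) => l lS.
    case: (eqVneq l i) => [->|li]; first by rewrite gi lexI !dS.
    by case: (eqVneq l j) => [->|lj]; [rewrite gj lexUl // dS | rewrite gl ?dS].
  apply: (@orderization_ge _ _ (j |: (S :\ i))); first by rewrite swap.
  move=> l; rewrite !inE => /orP[/eqP->|/andP[li lS]]; first by rewrite gj lexUl // dS.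
  by rewrite gl ?dS //; apply: contraNneq jS => <-.
Qed.

End Sorting.

(** * Passage between orthosymmetry and orderization invariance for multilinear maps *)

Section Multilinear.
Context {R : realType} {n : nat} {E : vectorLatticeType R}.
Context {Y : convexBornologicalType R} (Ysep : separated_bornology Y).
Context (T : {ffun 'I_n -> E} -> Y) (T_lin : multilinear T).
Local Open Scope classical_set_scope.

(** Freezing the coordinates other than [i] and [j] gives a bilinear map to which
    [bounded_bilinear_symmetric] applies. *)
Lemma orthosymmetric_swap i j (f : {ffun 'I_n -> E}) x y :
    bounded_map T -> orthosymmetric T -> i != j ->
  T (subst_coord (subst_coord f i x) j y) = T (subst_coord (subst_coord f i y) j x).
Proof.
move=> T_bd T_orth ij; pose B x y := T (subst_coord (subst_coord f i x) j y).
apply: (bounded_bilinear_symmetric Ysep B) => [z|z|u v uv0|u].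
- by move=> a u v; rewrite /B !(subst_coordC _ _ _ ij); apply: T_lin.
- exact: T_lin.
- apply: T_orth; exists i, j; rewrite !ffunE eqxx (negPf ij) eqxx.
  by rewrite !ge0_vabs // -uv0 ?leIl ?leIr.
pose A k := if (k == i) || (k == j) then [set x | 0 <= x <= u] else [set f k].
apply: (bornology_sub _ _ _ (T_bd A _)) => [_ [v v_bd [w w_bd <-]]|k].
  exists (subst_coord (subst_coord f i v) j w) => // k; rewrite /A !ffunE.
  by case: (eqVneq k j) => [_|_]; [rewrite orbT | case: (eqVneq k i)].
rewrite /A; case: ifP => _; last by split; exists (f k) => _ ->.
by split; [exists 0 | exists u] => v /andP[].
Qed.

(** With [h = vpos (a - b)], meet and join are [a - h] and [b + h]. By symmetry [B (a - h) (b + h) =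
    B a b + B h (a - b) - B h h], and the last two terms cancel since [h] is disjoint from the
    negative part of [a - b]. *)
Lemma orthosymmetric_sort2 i j (f : {ffun 'I_n -> E}) :
  bounded_map T -> orthosymmetric T -> i != j -> T (sort2 i j f) = T f.
Proof.
move=> T_bd T_orth ij; pose B x y := T (subst_coord (subst_coord f i x) j y).
have linl y : linear (B^~ y).
  by move=> a u v; rewrite /B !(subst_coordC _ _ _ ij); apply: T_lin.
have linr x : linear (B x) by exact: T_lin.
set a := f i; set b := f j; pose h := vpos (a - b).
have joinE : (a `|` b)%O = b + h.
  by rewrite /h /vpos [b + _]addrC vjoin_addr subrK add0r.
have meetE : (a `&` b)%O = a - h.
  apply: (addIr (a `|` b)%O).
  by rewrite vaddr_meet_join joinE [b + h]addrC addrA subrK.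
have Bh : B h a - B h b = B h h.
  rewrite -(linB (linr _)) -[a - b]vposB (linB (linr _)) -/h.
  rewrite [B h (vpos _)](_ : _ = 0) ?subr0 //.
  apply: T_orth; exists i, j; rewrite !ffunE eqxx (negPf ij) eqxx.
  by rewrite !ge0_vabs ?vpos_ge0 ?vpos_disjoint.
transitivity (B (a - h) (b + h)); first by rewrite -joinE -meetE.
have -> : T f = B a b.
  rewrite /B subst_coord_id /a.
  by rewrite -{1}(subst_coord_id f j).
have sym : B a h = B h a by apply: orthosymmetric_swap.
by rewrite (linB (linl _)) !(linD (linr _)) sym -Bh [B h b + _]addrC subrK addrK.
Qed.

Lemma total_orderization_of_orthosymmetric :
  bounded_map T -> orthosymmetric T -> total_orderization_invariant T.
Proof.
move=> T_bd T_orth f.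
have [|//|g g_homo [<- <-]] := @selection_sort R E n
    (fun g => T g = T f /\ orderization g = orderization f) f.
  move=> i j g ij [gT gM]; have ij' : i != j by rewrite -val_eqE neq_ltn ij.
  by rewrite orthosymmetric_sort2 // orderization_sort2.
by rewrite orderization_homo.
Qed.

Lemma positive_orderization_disjoint (f : {ffun 'I_n -> E}) i j :
    positively_total_orderization_invariant T ->
  (forall k, 0 <= f k) -> (f i `&` f j = 0)%O -> T f = 0.
Proof.
move=> T_pos f0 fij; have n_gt0 : (0 < n)%N by apply: leq_ltn_trans (ltn_ord i).
rewrite (T_pos f f0); pose k0 := Ordinal n_gt0.
(* At index 0 only the full index set occurs, so each lower bound [d] lies below
   [f i /\ f j = 0]. *)
have M0 : orderization f k0 = 0.
  apply/le_anti/andP; split.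
    apply/orderization_leP => S; rewrite subn0 => cS d dS.
    have ST k : k \in S.
      suff -> : S = [set: 'I_n]%SET by rewrite inE.
      by apply/eqP; rewrite eqEcard finset.subsetT cardsT card_ord cS /=.
    by rewrite -fij lexI !dS.
  apply: (@orderization_ge _ _ _ _ _ [set: 'I_n]%SET) => //.
  by rewrite cardsT card_ord subn0.
rewrite -(subst_coord_id (orderization f) k0) M0.
exact: (lin0 (T_lin k0 _)).
Qed.

(** The induction is on the number [m] of leading coordinates whose sign is unrestricted. *)
Lemma orthosymmetric_of_positive :
  positively_total_orderization_invariant T -> orthosymmetric T.
Proof.
move=> T_pos f [i [j fij]].
suff H m (g : {ffun 'I_n -> E}) : (vabs (g i) `&` vabs (g j) = 0)%O ->
    (forall k : 'I_n, (m <= k)%N -> 0 <= g k) -> T g = 0.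
  by apply: (H n) => // k; rewrite leqNgt ltn_ord.
elim: m g => [|m IHm] g gij g_ge0.
  have g0 k : 0 <= g k by apply: g_ge0.
  by apply: (positive_orderization_disjoint _ _ _ T_pos g0); rewrite -gij !ge0_vabs.
case: (leqP n m) => [nm|mn].
  by apply: IHm => // k mk; have := ltn_ord k; lia.
pose k0 := Ordinal mn.
(* Putting some [x] of [[0, vabs (g k0)]] at coordinate [m] keeps the disjointness and makes that
   coordinate nonnegative, so the induction hypothesis applies; both parts of [g k0] are such
   [x]. *)
have vanish (x : E) : 0 <= x -> x <= vabs (g k0) -> T (subst_coord g k0 x) = 0.
  move=> x0 xg; have le_g k : vabs (subst_coord g k0 x k) <= vabs (g k).
    by rewrite ffunE; case: eqP => // ->; rewrite ge0_vabs.
  apply: IHm => [|k mk].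
    by apply: (vmeet0_le _ _ _ _ _ _ _ _ gij); rewrite ?vabs_ge0 ?le_g.
  rewrite ffunE; case: eqP => // /eqP kk0; apply: g_ge0.
  by move: kk0; rewrite -val_eqE /=; lia.
rewrite -(subst_coord_id g k0) -(vposB (g k0)) (linB (T_lin k0 g)).
rewrite -!/(subst_coord _ _ _) !vanish ?subr0 ?vpos_ge0 //.
  exact: vposN_le_vabs.
exact: vpos_le_vabs.
Qed.

End Multilinear.

Theorem theorem3p18 (R : realType) (n : nat) (n_gt0 : (0 < n)%N)
    (E : vectorLatticeType R) (E_nontrivial : exists x : E, x != 0)
    (E_archimedean : archimedean_vlat E) (E_complete : uniformly_complete E)
    (Y : convexBornologicalType R) (Y_separated : separated_bornology Y)
    (T : {ffun 'I_n -> E} -> Y)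
    (T_multilinear : multilinear T) (T_bounded : bounded_map T) :
  [<-> orthosymmetric T;
       total_orderization_invariant T;
       positively_total_orderization_invariant T].
Proof.
tfae.
- exact: total_orderization_of_orthosymmetric.
- by move=> T_toi f _; apply: T_toi.
- exact: orthosymmetric_of_positive.
Qed.
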